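(* For every primitive set $A$ such that no element of $A$ is divisible by $8$, we have $$\sum_{a\in A}\frac{1}{a\log a} < C+2.37\times 10^{-7},\qquad\text{where } C=\sum_{p \text{ prime}}\frac{1}{p\log p}.$$
   Context: A set $A$ of integers greater than $1$ is called primitive if no element of $A$ divides any other element of $A$. (Numerically $C=1.63661632336\ldots$.) *)

(* Defs.v *)
From mathcomp Require Import all_boot all_order all_algebra.
From mathcomp Require Import all_classical all_reals all_analysis.

Set Implicit Arguments.
Unset Strict Implicit.
Unset Printing Implicit Defensive.

Import Order.TTheory GRing.Theory Num.Theory.
Local Open Scope classical_set_scope.
Local Open Scope ring_scope.

Definition primitive (A : set nat) : Prop :=
  (forall a, A a -> (1 < a)%N) /\
  (forall a b, A a -> A b -> a <> b -> ~~ (a %| b)%N).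

(* Meant for A containing only integers > 1: all terms are then positive, so
   this is the sum of the series, with value +oo exactly when it diverges. *)
Definition erdos_sum (R : realType) (A : set nat) : \bar R :=
  \esum_(a in A) ((a%:R * ln (a%:R : R))^-1)%:E.

Definition erdos_prime_sum (R : realType) : \bar R :=
  erdos_sum R [set p | prime p].

(* Main.v *)
Require Import Defs.
From mathcomp Require Import all_boot all_order all_algebra.
From mathcomp Require Import all_classical all_reals all_analysis.
From mathcomp Require Import ring lra zify.

Import Order.TTheory GRing.Theory Num.Theory.
Import numFieldNormedType.Exports.
Local Open Scope classical_set_scope.
Local Open Scope ring_scope.

(* Write w(n) = 1 / (n ln n) and send the flow w(n) Lambda(n/m) / ln n along each
   divisibility m | n.  As sum_{q | n} Lambda(q) = ln n, an integer n that is
   not a prime power receives exactly w(n), while m sends out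
   (1/m) sum_q Lambda(q) / (q ln(mq)^2).  Since the eta function increases,
   -zeta'/zeta(1+s) <= ln 2 / (2^s - 1) <= 2^(-s/2) / s, and integrating
   s m^(-s) against this bounds the outflow by 1 / (m (ln m + ln 2 / 2)), which
   is less than w(m).  At a prime m the excess pays for the inflow that the
   powers of m still miss.  A primitive set meets this flow at most once, so its
   total weight is at most that of the sources, the primes.  The case m = 2 also
   shows that the sum over primes is finite, which makes the inequality strict. *)

(** * The von Mangoldt function *)

Section VonMangoldt.
Variable R : realType.

Lemma ln_nat_ge0 n : 0 <= ln (n%:R : R).
Proof. case: n => [|n]; first by rewrite ln0. by rewrite ln_ge0// ler1n. Qed.

Lemma ln_nat_gt0 n : (1 < n)%N -> 0 < ln (n%:R : R).
Proof. by move=> n1; rewrite ln_gt0// ltr1n. Qed.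

Lemma ln_natM m n : (0 < m)%N -> (0 < n)%N ->
  ln ((m * n)%:R : R) = ln m%:R + ln n%:R.
Proof. by move=> m0 n0; rewrite natrM lnM// posrE ltr0n. Qed.

Lemma ler_ln_nat m n : (0 < m)%N -> (m <= n)%N -> ln (m%:R : R) <= ln n%:R.
Proof.
move=> m0 mn; rewrite ler_ln ?posrE ?ltr0n ?ler_nat//; exact: leq_trans mn.
Qed.

Lemma ln_natX n k : (0 < n)%N -> ln ((n ^ k)%:R : R) = k%:R * ln n%:R.
Proof. by move=> n0; rewrite natrX lnXn ?ltr0n// mulr_natl. Qed.

(** At 0 and 1 [pdiv] is 1 and the value is 0; elsewhere the test says that n is a power of its
    least prime factor. *)
Definition mangoldt (n : nat) : R :=
  if n == (pdiv n ^ logn (pdiv n) n)%N then ln (pdiv n)%:R else 0.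

Lemma mangoldt_ge0 n : 0 <= mangoldt n.
Proof. by rewrite /mangoldt; case: ifP => // _; exact: ln_nat_ge0. Qed.

Lemma mangoldt1 : mangoldt 1 = 0.
Proof. by rewrite /mangoldt ln1; case: (_ == _). Qed.

Lemma mangoldtX p k : prime p -> mangoldt (p ^ k.+1) = ln p%:R.
Proof. by move=> pp; rewrite /mangoldt pdiv_pfactor// pfactorK// eqxx. Qed.

Lemma mangoldt_prime p : prime p -> mangoldt p = ln p%:R.
Proof. by move=> pp; rewrite -{1}(expn1 p) mangoldtX. Qed.

Lemma mangoldt_neq0 n : mangoldt n != 0 ->
  exists p k, prime p /\ n = (p ^ k.+1)%N.
Proof.
rewrite /mangoldt; case: ifPn => [/eqP En|]; last by rewrite eqxx.
case: (ltnP 1 n) => [n1 _|].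
  have pp := pdiv_prime n1; exists (pdiv n), (logn (pdiv n) n).-1; split=> //.
  by rewrite prednK// logn_gt0 mem_primes pp pdiv_dvd (ltnW n1).
by case: n En => [|[|n]]//= _ _; rewrite ln1 eqxx.
Qed.

(** Passing from m to p m creates exactly one new prime power divisor, p^(v_p(m) + 1). *)
Lemma mangoldt_dvd_primeM p m q : prime p -> (0 < m)%N ->
  (if (q %| p * m)%N then mangoldt q else 0) =
  (if (q %| m)%N then mangoldt q else 0) +
  (if q == (p ^ (logn p m).+1)%N then ln p%:R else 0).
Proof.
move=> pp m0; have pm0 : (0 < p * m)%N by rewrite muln_gt0 prime_gt0.
have [q0|/mangoldt_neq0[r [k [rp ->]]]] := eqVneq (mangoldt q) 0.
  rewrite q0 !if_same add0r; case: eqP => // qE.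
  by rewrite -(mangoldtX p (logn p m) pp) -qE q0.
rewrite mangoldtX// !pfactor_dvdn// lognM ?(prime_gt0 pp)//.
rewrite (logn_prime r pp).
have [->|rp'] := eqVneq r p; last first.
  rewrite add0n; case: eqP => [|_]; last by rewrite addr0.
  move=> /(congr1 pdiv); rewrite !pdiv_pfactor// => E.
  by rewrite E eqxx in rp'.
rewrite add1n ltnS eqn_exp2l ?prime_gt1// eqSS.
by case: ltngtP; rewrite ?addr0 ?add0r.
Qed.

(** Strong induction, stripping the least prime factor; [Q] exceeds m so that all divisors of m are
    in range. *)
Lemma sum_mangoldt_dvd m Q : (0 < m < Q)%N ->
  \sum_(1 <= q < Q | (q %| m)%N) mangoldt q = ln m%:R.
Proof.
elim/ltn_ind: m => m IH /andP[m0 mQ].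
have [m1|m1] := leqP m 1.
  have -> : m = 1%N by apply/eqP; rewrite eqn_leq m1.
  by rewrite ln1 big1// => q; rewrite dvdn1 => /eqP ->; exact: mangoldt1.
have pp := pdiv_prime m1; set p := pdiv m in pp.
have mE : (p * (m %/ p))%N = m by rewrite mulnC divnK// pdiv_dvd.
have m'0 : (0 < m %/ p)%N by rewrite divn_gt0 ?prime_gt0// dvdn_leq// pdiv_dvd.
have m'm : (m %/ p < m)%N by rewrite ltn_Pdiv// prime_gt1.
rewrite -{2}mE ln_natM ?(prime_gt0 pp)//.
rewrite -(IH _ m'm) ?m'0 ?(ltn_trans m'm)//.
rewrite big_mkcond (eq_bigr (fun q => (if (q %| m %/ p)%N then mangoldt q else 0)
   + (if q == (p ^ (logn p (m %/ p)).+1)%N then ln p%:R else 0))); last first.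
  by move=> q _; rewrite -[X in (q %| X)%N]mE mangoldt_dvd_primeM.
rewrite big_split/= -big_mkcond addrC; congr (_ + _).
rewrite -big_mkcond/= big_nat1_eq.
rewrite expn_gt0 prime_gt0//=.
rewrite (leq_ltn_trans _ mQ)//; apply: dvdn_leq => //.
by rewrite -[X in (_ %| X)%N]mE expnS dvdn_pmul2l ?(prime_gt0 pp)// pfactor_dvdnn.
Qed.

Lemma sum_mangoldt_dvd_le m Q : (0 < m)%N ->
  \sum_(1 <= q < Q | (q %| m)%N) mangoldt q <= ln m%:R.
Proof.
move=> m0; rewrite -(sum_mangoldt_dvd m (maxn Q m.+1)) ?m0 ?leq_max ?ltnSn ?orbT//.
case: (posnP Q) => [->|Q0].
  by rewrite big_geq// sumr_ge0// => *; exact: mangoldt_ge0.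
rewrite (big_cat_nat Q0 (leq_maxl _ _))/= lerDl sumr_ge0// => *.
exact: mangoldt_ge0.
Qed.

End VonMangoldt.

(** * Partial sums of zeta and of its derivative at 1 + s *)

Section DirichletSums.
Variables (R : realType) (s : R).
Hypothesis s0 : 0 < s.

(** This is n^-(1+s); the next two sums are partial sums of zeta(1+s) and -zeta'(1+s), and [v] is
    2^-s. *)
Definition zeta_term (n : nat) : R := n%:R^-1 * expR (- (s * ln n%:R)).

Definition zeta_sum N : R := \sum_(1 <= n < N.+1) zeta_term n.

Definition log_zeta_sum N : R := \sum_(1 <= n < N.+1) ln n%:R * zeta_term n.

Let v : R := expR (- (s * ln 2%:R)).

Lemma zeta_term_ge0 n : 0 <= zeta_term n.
Proof. by rewrite mulr_ge0 ?invr_ge0// expR_ge0. Qed.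

Lemma zeta_termM m n : (0 < m)%N -> (0 < n)%N ->
  zeta_term (m * n) = zeta_term m * zeta_term n.
Proof.
move=> m0 n0; rewrite /zeta_term ln_natM// natrM invfM mulrDr opprD expRD.
by ring.
Qed.

Lemma zeta_term1 : zeta_term 1 = 1.
Proof. by rewrite /zeta_term ln1 mulr0 oppr0 expR0 invr1 mulr1. Qed.

Lemma ler_expR_ln m n : (0 < m)%N -> (m <= n)%N ->
  expR (- (s * ln (n%:R : R))) <= expR (- (s * ln m%:R)).
Proof. by move=> m0 mn; rewrite ler_expR lerN2 ler_pM2l// ler_ln_nat. Qed.

Lemma zeta_term_le m n : (0 < m)%N -> (m <= n)%N -> zeta_term n <= zeta_term m.
Proof.
move=> m0 mn; rewrite ler_pM ?invr_ge0 ?expR_ge0 ?ler_expR_ln//.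
by rewrite lef_pV2 ?posrE ?ltr0n ?ler_nat// (leq_trans m0).
Qed.

Lemma two_powN_gt0 : 0 < v. Proof. exact: expR_gt0. Qed.

Lemma two_powN_lt1 : v < 1.
Proof. by rewrite expR_lt1 oppr_lt0 mulr_gt0// ln_nat_gt0. Qed.

Lemma zeta_term2M n : (0 < n)%N -> 2%:R * zeta_term (2 * n) = v * zeta_term n.
Proof.
move=> n0; rewrite zeta_termM// /zeta_term -/v !mulrA divff ?mul1r//.
Qed.

Lemma sum_odd_even (F : nat -> R) N :
  \sum_(1 <= n < (2 * N).+2) F n =
  F 1%N + \sum_(1 <= i < N.+1) (F (2 * i)%N + F (2 * i).+1).
Proof.
elim: N => [|N IH]; first by rewrite big_nat1 big_geq// addr0.
rewrite mulnS !addSn add0n big_nat_recr//= big_nat_recr//= IH.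
by rewrite [in RHS]big_nat_recr//= mulnS !addSn add0n !addrA.
Qed.

Lemma zeta_sum_le M N : (M <= N)%N -> zeta_sum M <= zeta_sum N.
Proof.
move=> MN; rewrite /zeta_sum (big_cat_nat _ (_ : (M.+1 <= N.+1)%N))//=.
by rewrite lerDl sumr_ge0// => n _; exact: zeta_term_ge0.
Qed.

Lemma log_zeta_sum_le M N : (M <= N)%N -> log_zeta_sum M <= log_zeta_sum N.
Proof.
move=> MN; rewrite /log_zeta_sum (big_cat_nat _ (_ : (M.+1 <= N.+1)%N))//=.
by rewrite lerDl sumr_ge0// => n _; rewrite mulr_ge0 ?zeta_term_ge0 ?ln_nat_ge0.
Qed.

(** Each odd term past the first is at most the even term before it, and the doubled even terms give
    [v] times the sum. Hence the sum Z satisfies Z <= 1 + v Z. *)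
Lemma zeta_sum_bounded N : zeta_sum N <= (1 - v)^-1.
Proof.
have v1 := two_powN_lt1.
rewrite -div1r ler_pdivlMr ?subr_gt0//.
suff : zeta_sum N <= 1 + v * zeta_sum N by lra.
apply: le_trans (_ : zeta_sum (2 * N).+1 <= _).
  by apply: zeta_sum_le; lia.
rewrite /zeta_sum sum_odd_even zeta_term1 lerD2l big_distrr/=.
rewrite big_nat_cond [leRHS]big_nat_cond ler_sum// => i /andP[/andP[i0 _] _].
rewrite -zeta_term2M//.
have /= := @zeta_term_le (2 * i) (2 * i).+1 _ (leqnSn _).
by rewrite muln_gt0 i0 => /(_ isT); lra.
Qed.

Lemma ln2_ge_half : 2^-1 <= ln (2%:R : R).
Proof.
have : ln (1 + - 2^-1 : R) <= - 2^-1 by apply: le_ln1Dx; lra.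
have -> : 1 + - 2^-1 = 2%:R^-1 :> R by field.
by rewrite lnV ?posrE//; lra.
Qed.

(* ln x / x decreases from e on; 4 is enough here *)
Lemma log_zeta_term_le n : (4 <= n)%N ->
  ln n.+1%:R * zeta_term n.+1 <= ln n%:R * zeta_term n.
Proof.
move=> n4; have n0 : (0 < n)%N by lia.
rewrite /zeta_term !mulrA ler_pM ?expR_ge0 ?ler_expR_ln//.
  by rewrite mulr_ge0 ?ln_nat_ge0 ?invr_ge0.
have nR : 0 < (n%:R : R) by rewrite ltr0n.
have nR1 : 0 < (n.+1%:R : R) by rewrite ltr0n.
rewrite ler_pdivrMr// mulrAC ler_pdivlMr//.
have lnS : ln (n.+1%:R : R) <= ln n%:R + n%:R^-1.
  have -> : (n.+1%:R : R) = n%:R * (1 + n%:R^-1).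
    by rewrite mulrDr mulr1 divff ?gt_eqF// -natr1.
  have n'0 : 0 < n%:R^-1 :> R by rewrite invr_gt0.
  by rewrite lnM ?posrE// ?addr_gt0// lerD2l le_ln1Dx// (lt_trans _ n'0).
have ln1n : 1 <= ln (n%:R : R).
  apply: le_trans (ler_ln_nat R 4 n isT n4).
  by rewrite (ln_natX R 2 2)//; have := ln2_ge_half; lra.
rewrite -[in leRHS]natr1 mulrDr mulr1.
apply: le_trans (_ : (ln n%:R + n%:R^-1) * n%:R <= _).
  by rewrite ler_pM2r.
by rewrite mulrDl mulVf ?gt_eqF// lerD2l.
Qed.


(* The first two pairs of the alternating series for -eta'(1 + s); the
   numerical content is 3^5 <= 2^8 and 5^3 <= 2^7. *)
Lemma log_zeta_term_35 :
  ln 3%:R * zeta_term 3 + ln 5%:R * zeta_term 5 <=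
  ln 2%:R * zeta_term 2 + ln 4%:R * zeta_term 4.
Proof.
(* [w] is 2^(-s/2): then 2^-s = w^2 and 4^-s = w^4, while 3^-s <= w^3 since 2^3 <= 3^2, and 5^-s <=
   w^4. *)
pose w := expR (- (s * ln (2%:R : R) / 2%:R)).
have w0 : 0 < w by exact: expR_gt0.
have ln2 := @ln_nat_gt0 R 2 isT.
have w1 : w < 1 by rewrite expR_lt1 oppr_lt0 divr_gt0// mulr_gt0.
have ln4 : ln (4%:R : R) = 2%:R * ln 2%:R by rewrite -(ln_natX R 2 2).
have e2 : expR (- (s * ln (2%:R : R))) = w ^+ 2.
  by rewrite expr2 -expRD; congr expR; field.
have e4 : expR (- (s * ln (4%:R : R))) = w ^+ 4.
  by rewrite -expRM_natl; congr expR; rewrite ln4; field.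
have e5 : expR (- (s * ln (5%:R : R))) <= w ^+ 4.
  by rewrite -e4 ler_expR_ln.
have h3 : 3%:R * ln (2%:R : R) <= 2%:R * ln 3%:R.
  by rewrite -(ln_natX R 2 3)// -(ln_natX R 3 2)// ler_ln_nat.
have e3 : expR (- (s * ln (3%:R : R))) <= w ^+ 3.
  rewrite -expRM_natl ler_expR.
  have : s * (3%:R * ln (2%:R : R)) <= s * (2%:R * ln 3%:R) by rewrite ler_pM2l.
  lra.
have h5 : 5%:R * ln (3%:R : R) + 3%:R * ln 5%:R <= 15%:R * ln 2%:R.
  have h3' : 5%:R * ln (3%:R : R) <= 8%:R * ln 2%:R.
    by rewrite -(ln_natX R 3 5)// -(ln_natX R 2 8)// ler_ln_nat.
  have h5' : 3%:R * ln (5%:R : R) <= 7%:R * ln 2%:R.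
    by rewrite -(ln_natX R 5 3)// -(ln_natX R 2 7)// ler_ln_nat.
  lra.
have h25 : ln (2%:R : R) <= ln 5%:R by rewrite ler_ln_nat.
have ln3 : ln (2%:R : R) <= ln 3%:R by rewrite ler_ln_nat.
rewrite /zeta_term e2 e4 ln4.
set a := ln (2%:R : R) in ln2 ln4 h3 h5 h25 ln3 *.
set b := ln (3%:R : R) in h3 h5 ln3 *; set c := ln (5%:R : R) in h5 h25 *.
have E3 : b * (3%:R^-1 * expR (- (s * b))) <= b / 3%:R * w ^+ 3.
  by rewrite mulrA ler_pM2l// divr_gt0//; lra.
have E5 : c * (5%:R^-1 * expR (- (s * c))) <= c / 5%:R * w ^+ 4.
  by rewrite mulrA ler_pM2l// divr_gt0//; lra.
apply: le_trans (lerD E3 E5) _; rewrite -subr_ge0.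
(* With w^2 factored out, the quadratic in w is split so that its value at w = 1, a - b/3 - c/5,
   becomes a coefficient; [h5] makes it nonnegative. *)
have -> : a * (2%:R^-1 * w ^+ 2) + 2%:R * a * (4%:R^-1 * w ^+ 4)
    - (b / 3%:R * w ^+ 3 + c / 5%:R * w ^+ 4) =
  w ^+ 2 * ((a - b / 3%:R - c / 5%:R) * w
    + (1 - w) * ((a / 2%:R) - (a / 2%:R - c / 5%:R) * w)).
  by field.
rewrite mulr_ge0 ?exprn_ge0 ?(ltW w0)// addr_ge0//.
  by rewrite mulr_ge0 ?(ltW w0)//; lra.
rewrite mulr_ge0 ?subr_ge0 ?(ltW w1)//.
apply: le_trans (_ : (a / 2%:R - c / 5%:R) <= _); last by lra.
rewrite ler_piMr ?(ltW w1)//; lra.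
Qed.

(** The right side is twice the sum of the even terms, so the claim is that odd terms weigh no more
    than even ones: eta'(1+s) >= 0, truncated. The pair (2, 3) alone can fail, so the induction
    starts from two pairs. *)
Lemma log_zeta_sum_odd_le N : (2 <= N)%N ->
  log_zeta_sum (2 * N).+1 <= v * (ln 2%:R * zeta_sum N + log_zeta_sum N).
Proof.
pose g n := ln (n%:R : R) * zeta_term n.
move=> N2; have -> : v * (ln 2%:R * zeta_sum N + log_zeta_sum N) =
    2%:R * \sum_(1 <= i < N.+1) g (2 * i)%N.
  rewrite /zeta_sum /log_zeta_sum big_distrr -big_split/= !big_distrr/=.
  apply: eq_big_nat => i /andP[i0 _]; rewrite /g ln_natM//.
  rewrite [RHS]mulrCA zeta_term2M//; ring.
rewrite /log_zeta_sum sum_odd_even ln1 mul0r add0r big_split/= -/g.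
rewrite [leRHS](_ : _ = \sum_(1 <= i < N.+1) g (2 * i)%N +
  \sum_(1 <= i < N.+1) g (2 * i)%N); last by ring.
rewrite lerD2l; elim: N N2 => // N IH; rewrite leq_eqVlt => /predU1P[<-|N2].
  rewrite !(@big_ltn _ _ _ 1 3)// !(@big_ltn _ _ _ 2 3)// !big_geq// !addr0.
  exact: log_zeta_term_35.
rewrite big_nat_recr//= [leRHS]big_nat_recr//= lerD ?IH//.
by apply: log_zeta_term_le; lia.
Qed.

(** A finite form of -zeta' <= zeta ln 2 / (2^s - 1), obtained by moving [v * log_zeta_sum N] to the
    left. *)
Lemma log_zeta_sum_le_zeta_sum N : (2 <= N)%N ->
  (1 - v) * log_zeta_sum N <= v * ln 2%:R * zeta_sum N.
Proof.
move=> N2; have := log_zeta_sum_odd_le N N2.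
have NN : log_zeta_sum N <= log_zeta_sum (2 * N).+1.
  by apply: log_zeta_sum_le; lia.
lra.
Qed.

End DirichletSums.

(** * The logarithmic derivative of zeta *)

Section MangoldtSums.
Variable R : realType.

Lemma sum_multiples_le (F : nat -> R) q N M :
  (0 < q)%N -> (q * N <= M)%N -> (forall m, 0 <= F m) ->
  \sum_(1 <= n < N.+1) F (q * n)%N <= \sum_(1 <= m < M.+1 | (q %| m)%N) F m.
Proof.
move=> q0 + F0; elim: N M => [|N IH] M qNM.
  by rewrite big_geq// sumr_ge0.
have qN1 : (0 < q * N.+1)%N by rewrite muln_gt0 q0.
have ltqN : (q * N < q * N.+1)%N by rewrite ltn_pmul2l.
rewrite big_nat_recr//=.
rewrite (big_cat_nat _ (_ : (q * N.+1 <= M.+1)%N))//=; last by rewrite leqW.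
apply: lerD; first by rewrite -(prednK qN1); apply: IH; lia.
by rewrite big_ltn_cond ?ltnS// dvdn_mulr// lerDl sumr_ge0.
Qed.

(** The Dirichlet convolution Lambda * 1 = ln, truncated: all products q n are at most Q N, and each
    m collects at most ln m. *)
Lemma mangoldt_zeta_sum_le (s : R) (s0 : 0 < s) Q N :
  (\sum_(1 <= q < Q) mangoldt R q * zeta_term R s q) * zeta_sum R s N <=
  log_zeta_sum R s (Q * N).
Proof.
rewrite big_distrl/=.
apply: le_trans (_ : \sum_(1 <= q < Q)
  \sum_(1 <= m < (Q * N).+1 | (q %| m)%N) mangoldt R q * zeta_term R s m <= _).
  rewrite big_nat_cond [leRHS]big_nat_cond; apply: ler_sum => q.
  rewrite andbT => /andP[q0 qQ].
  have -> : mangoldt R q * zeta_term R s q * zeta_sum R s N =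
      \sum_(1 <= n < N.+1) mangoldt R q * zeta_term R s (q * n).
    rewrite /zeta_sum big_distrr/=; apply: eq_big_nat => n /andP[n0 _].
    by rewrite zeta_termM// mulrA.
  apply: (sum_multiples_le (fun m => mangoldt R q * zeta_term R s m)) => //.
    by rewrite leq_mul2r (ltnW qQ) orbT.
  by move=> m; rewrite mulr_ge0 ?mangoldt_ge0 ?zeta_term_ge0.
rewrite (exchange_big_dep_nat xpredT)//= /log_zeta_sum.
rewrite big_nat_cond [leRHS]big_nat_cond; apply: ler_sum => m.
rewrite andbT => /andP[m0 _]; rewrite -big_distrl/=.
by rewrite ler_wpM2r ?zeta_term_ge0// sum_mangoldt_dvd_le.
Qed.

(* Take the supremum over N in mangoldt_zeta_sum_le combined with
   log_zeta_sum_le_zeta_sum: this is -zeta'/zeta(1+s) <= ln 2 / (2^s - 1). *)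
Lemma sum_mangoldt_zeta_term_le (s : R) (s0 : 0 < s) Q :
  (1 - expR (- (s * ln 2%:R))) *
    \sum_(1 <= q < Q) mangoldt R q * zeta_term R s q <=
  expR (- (s * ln 2%:R)) * ln 2%:R.
Proof.
set v := expR _; set S := \sum_(1 <= q < Q) _.
have v0 : 0 < v by exact: two_powN_gt0.
have v1 : v < 1 by exact: two_powN_lt1.
have S0 : 0 <= S.
  by apply: sumr_ge0 => q _; rewrite mulr_ge0 ?mangoldt_ge0 ?zeta_term_ge0.
pose Z := [set zeta_sum R s N | N in [set: nat]].
have Zsup : has_sup Z.
  split; first by exists (zeta_sum R s 1), 1%N.
  by exists (1 - v)^-1 => _ [N _ <-]; exact: zeta_sum_bounded.
have Zle N : zeta_sum R s N <= sup Z by apply: sup_upper_bound => //; exists N.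
have Zpos : 0 < sup Z.
  apply: lt_le_trans (Zle 1%N).
  by rewrite /zeta_sum big_nat1 zeta_term1.
(* [maxn N 2] and [Q.+1] only ensure the length of at least 2 that the bound on [log_zeta_sum]
   requires. *)
have key N : (1 - v) * S * zeta_sum R s N <= v * ln 2%:R * sup Z.
  have NN : zeta_sum R s N <= zeta_sum R s (maxn N 2).
    by apply: zeta_sum_le; rewrite leq_maxl.
  have QN : log_zeta_sum R s (Q * maxn N 2) <= log_zeta_sum R s (Q.+1 * maxn N 2).
    by apply: log_zeta_sum_le; rewrite leq_mul2r leqnSn orbT.
  have := @log_zeta_sum_le_zeta_sum R s s0 (Q.+1 * maxn N 2)%N.
  have -> : (2 <= Q.+1 * maxn N 2)%N by lia.
  move=> /(_ isT); rewrite -/v => le1.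
  have c0 : 0 <= v * ln (2%:R : R) by rewrite mulr_ge0 ?ltW// ln_nat_gt0.
  have le2 := ler_wpM2l c0 (Zle (Q.+1 * maxn N 2)%N).
  have le3 := mangoldt_zeta_sum_le s s0 Q (maxn N 2).
  have le4 := ler_wpM2l S0 NN; rewrite -/S in le3.
  rewrite -mulrA; apply: le_trans le2; apply: le_trans le1.
  by rewrite ler_wpM2l ?subr_ge0 ?(ltW v1)//; lra.
rewrite -(ler_pM2r Zpos).
have [-> |Sn0] := eqVneq S 0.
  by rewrite mulr0 mul0r !mulr_ge0 ?(ltW Zpos) ?(ltW v0) ?ln_nat_ge0.
have c0 : 0 < (1 - v) * S by rewrite mulr_gt0 ?subr_gt0// lt0r Sn0.
rewrite mulrC -ler_pdivlMr//; apply: ge_sup.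
  by exists (zeta_sum R s 1), 1%N.
by move=> _ [N _ <-]; rewrite ler_pdivlMr// mulrC.
Qed.

(** That is, sinh y >= y: the derivative e^x + e^-x - 2 is nonnegative because e^t >= 1 + t at t = x
    and t = -x. *)
Lemma double_le_expRBexpRN (y : R) : 0 <= y -> 2%:R * y <= expR y - expR (- y).
Proof.
move=> y0; pose f (x : R) : R := expR x - expR (- x) - 2%:R * x.
have df (x : R) : is_derive x 1 f (expR x + expR (- x) - 2%:R).
  rewrite /f; apply: is_derive_eq.
  by rewrite /GRing.scale/= !mulr1 !mulrN1 opprK.
have [|c _] := @MVT_segment R f _ 0 y y0 (fun x _ => df x).
  apply: derivable_within_continuous => x _.
  by have [] := df x.
rewrite /f !oppr0 subrr mulr0 !(oppr0, addr0) => fE.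
rewrite -subr_ge0 fE mulr_ge0//.
have := expR_ge1Dx c; have := expR_ge1Dx (- c); lra.
Qed.

(** With y = s ln 2 / 2, ln 2 / (2^s - 1) = (ln 2 / 2) e^-y / sinh y, and sinh y >= y turns this
    into e^-y / s, a form easy to integrate against s m^-s. *)
Lemma sum_mangoldt_zeta_term_le_expR (s : R) (s0 : 0 < s) Q :
  s * \sum_(1 <= q < Q) mangoldt R q * zeta_term R s q <=
  expR (- (s * (ln 2%:R / 2%:R))).
Proof.
have := sum_mangoldt_zeta_term_le s s0 Q; set S := \sum_(1 <= q < Q) _ => /=.
have l0 : 0 < ln (2%:R : R) := ln_nat_gt0 R 2 isT.
set y := s * (ln 2%:R / 2%:R).
have y0 : 0 < y by rewrite mulr_gt0// divr_gt0.
have -> : s * ln 2%:R = y + y by rewrite /y; field.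
rewrite opprD expRD; set e := expR (- y).
have e0 : 0 < e := expR_gt0 _.
have e1 : e < 1 by rewrite expR_lt1 oppr_lt0.
have ee : expR y = e^-1 by rewrite /e expRN invrK.
have := double_le_expRBexpRN y (ltW y0); rewrite ee -/e => yle.
have eeI : e * e^-1 = 1 by rewrite mulfV// gt_eqF.
have h : 2%:R * y * e <= 1 - e * e.
  by move: yle; rewrite -(ler_pM2r e0) mulrBl mulVf ?gt_eqF.
move=> SE.
have c0 : 0 < 1 - e * e by apply: lt_le_trans h; rewrite !mulr_gt0.
rewrite -(ler_pM2l c0) mulrCA.
apply: le_trans (ler_wpM2l (ltW s0) SE) _.
have -> : s * (e * e * ln 2%:R) = (2%:R * y * e) * e by rewrite /y; field.
by rewrite ler_pM2r.
Qed.

End MangoldtSums.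

(** * Integration over s *)

Section Laplace.
Variable R : realType.

(* lap L S = int_0^S s expR(-s L) ds *)
Let lap (L S : R) : R := (1 - (1 + S * L) * expR (- (S * L))) / L ^+ 2.

Let is_derive_lap (L : R) : 0 < L -> forall x : R,
  is_derive x 1 (lap L) (x * expR (- (x * L))).
Proof.
move=> L0 x; rewrite /lap; apply: is_derive_eq.
rewrite /GRing.scale/=.
by field; rewrite gt_eqF.
Qed.

(** The hypothesis integrated over s > 0, since s e^(-sL) has integral 1/L^2 and e^(-sM) has
    integral 1/M. Antiderivatives and the mean value theorem handle the range up to S; the tail
    beyond S is then made small. *)
Lemma laplace_le n (c L : 'I_n -> R) (M : R) : 0 < M ->
  (forall i, 0 <= c i) -> (forall i, 0 < L i) ->
  (forall s, 0 < s -> s * \sum_i c i * expR (- (s * L i)) <= expR (- (s * M))) ->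
  \sum_i c i / L i ^+ 2 <= M^-1.
Proof.
move=> M0 c0 L0 H.
have trunc S : 0 < S -> \sum_i c i * lap (L i) S <= M^-1.
  (* [f] is the difference of the antiderivatives of the two sides; it vanishes at 0 and its
     derivative is nonnegative for x > 0. *)
  move=> S0; pose f : R -> R := fun x =>
    (1 - expR (- (x * M))) / M - \sum_i c i * lap (L i) x.
  have df (x : R) : is_derive x 1 f (expR (- (x * M)) -
      x * \sum_i c i * expR (- (x * L i))).
    have dlap i := is_derive_lap (L i) (L0 i) x.
    have -> : f = (fun x => (1 - expR (- (x * M))) / M) -
        \sum_i (c i *: lap (L i)).
      by apply/funext => y; rewrite /f !fctE fct_sumE.
    apply: is_derive_eq.
    rewrite /GRing.scale/= !mulr0 add0r; congr (_ + _).
      by field; rewrite gt_eqF.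
    by rewrite big_distrr/=; congr (- _); apply: eq_bigr => i _; rewrite mulrCA.
  have [|x] := @MVT R f _ 0 S S0 (fun x _ => df x).
    by apply: derivable_within_continuous => x _; have [] := df x.
  rewrite in_itv/= => /andP[x0 _].
  have -> : f 0 = 0.
    rewrite /f mul0r oppr0 expR0 subrr mul0r big1 ?subr0// => i _.
    by rewrite /lap mul0r addr0 oppr0 expR0 mulr1 subrr mul0r mulr0.
  rewrite !subr0 => fE.
  have fS : 0 <= f S by rewrite fE mulr_ge0 ?(ltW S0)// subr_ge0 H.
  move: fS; rewrite subr_ge0 => /le_trans; apply.
  by rewrite ler_pdivrMr// mulVf ?gt_eqF// gerBl expR_ge0.
(* This follows from e^y >= (1 + y/2)^2. It bounds what [lap] misses of 1/L^2 by 4 / (S L^3). *)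
have tail (y : R) : 0 < y -> (1 + y) * expR (- y) <= 4%:R / y.
  move=> y0; rewrite expRN ler_pdivrMr ?expR_gt0// mulrAC ler_pdivlMr//.
  have -> : expR y = expR (y / 2%:R) ^+ 2.
    by rewrite -expRM_natl; congr expR; field.
  have h := expR_ge1Dx (y / 2%:R).
  have : (1 + y / 2%:R) ^+ 2 <= expR (y / 2%:R) ^+ 2.
    by rewrite lerXn2r ?nnegrE ?expR_ge0//; lra.
  by lra.
pose K := \sum_i c i * (4%:R / L i ^+ 3).
have K0 : 0 <= K.
  by apply: sumr_ge0 => i _; rewrite mulr_ge0// divr_ge0// exprn_ge0// ltW.
apply/ler_addgt0Pr => e e0.
(* For this S the total tail K / S is at most e; the added 1 keeps S positive when K = 0. *)
have S0 : 0 < (K + 1) / e by rewrite divr_gt0// ltr_wpDl.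
apply: le_trans (lerD (trunc _ S0) (_ : K * ((K + 1) / e)^-1 <= e)); last first.
  rewrite invf_div mulrA ler_pdivrMr; last by rewrite ltr_wpDl.
  by rewrite mulrC ler_pM2l// lerDl.
rewrite /K big_distrl -big_split/=; apply: ler_sum => i _.
set S := (K + 1) / e in S0 *.
have Li := L0 i; have := tail _ (mulr_gt0 S0 Li).
set t := (1 + _) * _ => ht.
rewrite -mulrA -mulrDr ler_wpM2l//.
rewrite /lap -/t -subr_ge0.
have -> : (1 - t) / L i ^+ 2 + 4%:R / L i ^+ 3 / S - (L i ^+ 2)^-1 =
  (4%:R / (S * L i) - t) / L i ^+ 2.
  by field; rewrite !gt_eqF.
by rewrite divr_ge0 ?exprn_ge0 ?(ltW Li)// subr_ge0.
Qed.

End Laplace.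

(** * Flows on the divisibility order *)

Section Antichain.
Variable R : realType.

Lemma sum_ge_term (F : nat -> R) (P : pred nat) a b j :
  (forall i, 0 <= F i) -> (a <= j < b)%N -> P j ->
  F j <= \sum_(a <= i < b | P i) F i.
Proof.
move=> F0 jab Pj; rewrite big_mkcond (bigD1_seq j)/= ?mem_index_iota ?iota_uniq//.
by rewrite Pj lerDl sumr_ge0// => i _; case: ifP.
Qed.

(** Each i meets at most one n. This regroups the outflow of m by q in n = m q, or by k in n =
    m^k. *)
Lemma sum_fiber_le (P : pred nat) (h : nat -> nat) (G : nat -> nat -> R) a b X :
  (forall i n, 0 <= G i n) ->
  \sum_(1 <= n < X | P n) \sum_(a <= i < b | n == h i) G i n <=
  \sum_(a <= i < b) G i (h i).
Proof.
move=> G0; rewrite (exchange_big_dep_nat xpredT)//=; apply: ler_sum => i _.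
by rewrite big_nat1_cond_eq; case: ifP.
Qed.

(* Conservation: B collects the proper divisors of elements of A, so that A and
   B are disjoint and every flow into A or B comes out of B. *)
Lemma antichain_flow_le (w : nat -> R) (f : nat -> nat -> R) X (A : pred nat) :
  let E m n := [&& (1 < m)%N, (m < n)%N & (m %| n)%N] in
  (forall n, 0 <= w n) -> (forall m n, 0 <= f m n) ->
  (forall n, (1 < n < X)%N -> ~~ prime n ->
    w n <= \sum_(1 <= m < X | E m n) f m n) ->
  (forall m, (1 < m < X)%N -> \sum_(1 <= n < X | E m n) f m n <= w m) ->
  (forall a, A a -> (1 < a)%N) ->
  (forall a b, A a -> A b -> (a %| b)%N -> a = b) ->
  \sum_(1 <= a < X | A a) w a <= \sum_(1 <= p < X | prime p) w p.
Proof.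
move=> E w0 f0 inflow outflow A1 Aanti.
pose B n := [exists a : 'I_X, A a && E n a].
have BP n : reflect (exists2 a, (a < X)%N & A a && E n a) (B n).
  apply: (iffP existsP) => [[a Ea]|[a aX Ea]]; first by exists a.
  by exists (Ordinal aX).
have disj n : A n -> ~~ B n.
  move=> An; apply/BP => -[a _ /andP[Aa /and3P[_ na nda]]].
  by move: na; rewrite (Aanti n a) ?ltnn.
pose C n := A n || B n.
have C1 n : C n -> (1 < n)%N.
  by move=> /orP[/A1//|/BP[a _ /andP[_ /and3P[]]]].
have CB m n : (n < X)%N -> C n -> E m n -> B m.
  move=> nX /orP[An|/BP[a aX /andP[Aa /and3P[n1 na nda]]]] Emn; apply/BP.
    by exists n => //; rewrite An.
  case/and3P: Emn => m1 mn mdn; exists a => //; rewrite Aa /E m1 /=.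
  by rewrite (ltn_trans mn)// (dvdn_trans mdn).
have CE : \sum_(1 <= n < X | C n) w n =
    \sum_(1 <= n < X | A n) w n + \sum_(1 <= n < X | B n) w n.
  rewrite (bigID A)/=; congr (_ + _); apply: eq_bigl => n.
    by rewrite /C; case: (A n); rewrite ?andbF.
  rewrite /C; have := disj n.
  by case: (A n) => //= [/(_ isT)/negbTE -> | _]; rewrite ?andbT.
(* With the weight of B added to both sides, the primes in C are charged to all primes, and the
   other elements of C to B, where by [CB] their whole inflow originates. *)
rewrite -(lerD2r (\sum_(1 <= n < X | B n) w n)) -CE.
rewrite (bigID prime)/=; apply: lerD.
  rewrite [leRHS](bigID C)/= [X in X + _](eq_bigl (fun i => C i && prime i)).
    by rewrite lerDl sumr_ge0.
  by move=> i; rewrite andbC.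
apply: le_trans (_ : \sum_(1 <= n < X | C n && ~~ prime n)
    \sum_(1 <= m < X | E m n) f m n <= _).
  rewrite big_nat_cond [leRHS]big_nat_cond; apply: ler_sum.
  move=> n /andP[/andP[_ nX] /andP[Cn np]].
  by apply: inflow => //; rewrite C1.
rewrite (exchange_big_dep_nat B)/=; last first.
  by move=> n m /andP[_ nX] _ /andP[Cn _] Emn; exact: CB Emn.
rewrite big_nat_cond [leRHS]big_nat_cond; apply: ler_sum.
move=> m /andP[/andP[_ mX] Bm].
apply: le_trans (outflow m _); last by rewrite mX C1// /C Bm orbT.
rewrite [leRHS](bigID (fun n => C n && ~~ prime n))/=.
rewrite [X in X + _](eq_bigl (fun n => (C n && ~~ prime n) && E m n)).
  by rewrite lerDl sumr_ge0.
by move=> n; rewrite andbC.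
Qed.

End Antichain.

(** * The flow for the weights 1 / (n ln n) *)

Section Flow.
Variable R : realType.

(** An instance of [laplace_le] with c = Lambda(q) / q, L = ln(m q) and M = ln m + ln 2 / 2; its
    hypothesis is the exponential bound on the Mangoldt sum times m^-s. *)
Lemma sum_mangoldt_log2_le m Q : (1 < m)%N ->
  \sum_(1 <= q < Q) mangoldt R q / (q%:R * ln (m * q)%:R ^+ 2) <=
  (ln m%:R + ln 2%:R / 2%:R)^-1.
Proof.
move=> m1; have m0 : (0 < m)%N by lia.
have lm := ln_nat_gt0 R m m1; have l2 := ln_nat_gt0 R 2 isT.
rewrite big_add1 big_mkord.
pose c (i : 'I_Q.-1) := mangoldt R i.+1 / i.+1%:R.
pose L (i : 'I_Q.-1) := ln (m * i.+1)%:R : R.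
rewrite (eq_bigr (fun i => c i / L i ^+ 2)); last first.
  by move=> i _; rewrite /c /L invfM mulrA.
apply: laplace_le => [|i|i|s s0].
- by rewrite addr_gt0// divr_gt0.
- by rewrite divr_ge0// mangoldt_ge0.
- by rewrite ln_nat_gt0//; lia.
have H := @sum_mangoldt_zeta_term_le_expR R s s0 Q.
rewrite big_add1 big_mkord in H.
have -> : \sum_i c i * expR (- (s * L i)) = expR (- (s * ln m%:R)) *
   \sum_(i < Q.-1) mangoldt R i.+1 * zeta_term R s i.+1.
  rewrite big_distrr/=; apply: eq_bigr => i _.
  rewrite /c /L /zeta_term ln_natM// mulrDr opprD expRD; ring.
rewrite mulrDr opprD expRD mulrCA ler_pM2l ?expR_gt0//.
Qed.

Definition erdos_weight (n : nat) : R := (n%:R * ln n%:R)^-1.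

Lemma erdos_weight_ge0 n : 0 <= erdos_weight n.
Proof. by rewrite invr_ge0 mulr_ge0 ?ln_nat_ge0. Qed.

(* The first sum is the von Mangoldt flow.  It feeds n with the fraction
   1 - Lambda(n) / ln n of its weight, which falls short at prime powers; the
   second sum makes up for this directly from the prime. *)
Definition erdos_flow (X m n : nat) : R :=
  erdos_weight n / ln n%:R *
  (\sum_(1 <= q < X | n == (m * q)%N) mangoldt R q +
   \sum_(2 <= k < X | n == (m ^ k)%N) (if prime m then ln m%:R else 0)).

Lemma prime_ln_ge0 m : 0 <= (if prime m then ln m%:R else 0) :> R.
Proof. by case: ifP => // _; exact: ln_nat_ge0. Qed.

Lemma erdos_flow_ge0 X m n : 0 <= erdos_flow X m n.
Proof.
rewrite mulr_ge0 ?divr_ge0 ?erdos_weight_ge0 ?ln_nat_ge0//.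
by rewrite addr_ge0// sumr_ge0// => *; rewrite ?mangoldt_ge0 ?prime_ln_ge0.
Qed.

Let E m n := [&& (1 < m)%N, (m < n)%N & (m %| n)%N].

(** In ln n = sum of Lambda(q) over q | n, a divisor 1 < q < n is served by m = n/q. The term q = n
    counts only if n = p^k, with k >= 2 as n is not prime, and the second sum supplies it from m =
    p. *)
Lemma erdos_flow_in X n : (1 < n < X)%N -> ~~ prime n ->
  erdos_weight n <= \sum_(1 <= m < X | E m n) erdos_flow X m n.
Proof.
move=> /andP[n1 nX] np; have n0 : (0 < n)%N by lia.
have ln0 := ln_nat_gt0 R n n1.
rewrite -big_distrr/= -mulrA ler_peMr ?erdos_weight_ge0// mulrC ler_pdivlMr//.
rewrite mul1r big_split/= -(sum_mangoldt_dvd R n X) ?n0//.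
rewrite (bigID (pred1 n))/= addrC; apply: lerD.
  rewrite [leRHS](exchange_big_dep_nat xpredT)//= big_mkcond/=.
  rewrite big_nat_cond [leRHS]big_nat_cond; apply: ler_sum.
  move=> q /andP[/andP[q0 qX] _].
  have S0 : 0 <= \sum_(1 <= m < X | E m n && (n == (m * q)%N)) mangoldt R q.
    by rewrite sumr_ge0// => m _; rewrite mangoldt_ge0.
  case: ifP => // /andP[qdn qn].
  (* Here q = 1 would need m = n, which is no proper divisor, but Lambda(1) = 0. *)
  have [->|q1] := eqVneq q 1%N; first by rewrite mangoldt1 sumr_ge0.
  have nE : n = (n %/ q * q)%N by rewrite divnK.
  apply: (@sum_ge_term R (fun=> mangoldt R q) _ _ _ (n %/ q)%N).
  - by move=> _; exact: mangoldt_ge0.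
  - by rewrite divn_gt0// dvdn_leq//= (leq_ltn_trans (leq_div _ _)).
  - rewrite -nE eqxx andbT /E dvdn_div// andbT ltn_Pdiv ?andbT//; last by lia.
    by rewrite ltn_divRL// mul1n ltn_neqAle qn dvdn_leq.
rewrite big_nat1_cond_eq dvdnn n0 nX /=.
have T0 : 0 <= \sum_(1 <= m < X | E m n)
    \sum_(2 <= k < X | n == (m ^ k)%N) (if prime m then ln m%:R else 0) :> R.
  by rewrite sumr_ge0// => m _; rewrite sumr_ge0// => k _; exact: prime_ln_ge0.
have [-> //|/mangoldt_neq0[p [k [pp nE]]]] := eqVneq (mangoldt R n) 0.
case: k nE => [|k] nE; first by rewrite nE expn1 pp in np.
have kn : (k.+2 < n)%N by rewrite nE; apply: ltn_expl; exact: prime_gt1.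
have pn : (p < n)%N by rewrite nE -{1}(expn1 p) ltn_exp2l; [|exact: prime_gt1].
have pX : (p < X)%N by lia.
apply: le_trans (sum_ge_term R (fun m => \sum_(2 <= k < X | n == (m ^ k)%N)
  (if prime m then ln m%:R else 0)) (fun m => E m n) 1 X p _ _ _).
- apply: le_trans (sum_ge_term R (fun=> if prime p then ln p%:R else 0)
    (fun k => n == (p ^ k)%N) 2 X k.+2 _ _ _).
  + by rewrite pp {1}nE mangoldtX.
  + by move=> _; exact: prime_ln_ge0.
  + by rewrite /= (ltn_trans kn).
  + by rewrite -nE.
- by move=> m; rewrite sumr_ge0// => *; exact: prime_ln_ge0.
- by rewrite prime_gt0.
- by rewrite /E prime_gt1// pn nE dvdn_exp.
Qed.

Lemma geometric_tail_le (x : R) X : 0 <= x < 1 ->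
  (1 - x) * \sum_(2 <= k < X) x ^+ k <= x ^+ 2.
Proof.
move=> /andP[x0 x1]; case: X => [|[|X]]; try by rewrite big_geq// mulr0 exprn_ge0.
suff -> : (1 - x) * \sum_(2 <= k < X.+2) x ^+ k = x ^+ 2 - x ^+ X.+2.
  by rewrite gerBl exprn_ge0.
elim: X => [|X IH]; first by rewrite big_geq// mulr0 subrr.
by rewrite big_nat_recr//= mulrDr IH [x ^+ X.+3]exprS; ring.
Qed.

(** The term at k is 1 / (k^2 p^k ln p); use k^2 >= 4 and the geometric tail, at most 1 / (p (p -
    1)). *)
Lemma erdos_flow_out_prime_power p X : prime p ->
  \sum_(2 <= k < X) erdos_weight (p ^ k) / ln (p ^ k)%:R * ln p%:R <=
  (4%:R * ln p%:R * p%:R * (p%:R - 1))^-1.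
Proof.
move=> pp; have p1 := prime_gt1 pp; have p0 := prime_gt0 pp.
have l0 := ln_nat_gt0 R p p1; have pR : 0 < (p%:R : R) by rewrite ltr0n.
have pR1 : 1 < (p%:R : R) by rewrite ltr1n.
have x1 : 0 <= (p%:R : R)^-1 < 1 by rewrite invr_ge0 ltW//= invf_lt1.
apply: le_trans (_ : \sum_(2 <= k < X) (4%:R * ln p%:R)^-1 * p%:R^-1 ^+ k <= _).
  rewrite big_nat_cond [leRHS]big_nat_cond; apply: ler_sum.
  move=> k /andP[/andP[k2 _] _].
  have kR : 2%:R <= (k%:R : R) by rewrite ler_nat.
  have k0 : 0 < (k%:R : R) by lra.
  have -> : erdos_weight (p ^ k) / ln (p ^ k)%:R * ln p%:R =
      (k%:R ^+ 2 * ln p%:R)^-1 * p%:R^-1 ^+ k.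
    rewrite /erdos_weight ln_natX// natrX exprVn.
    by field; rewrite ?expf_neq0 ?gt_eqF.
  rewrite ler_wpM2r ?exprn_ge0 ?invr_ge0 ?(ltW pR)//.
  rewrite lef_pV2 ?posrE ?mulr_gt0// ?exprn_gt0// ler_pM2r//.
  by nra.
rewrite -big_distrr/=; have := geometric_tail_le _ X x1.
set S := \sum_(_ <= _ < _) _ => hS.
have {}hS : S <= (p%:R * (p%:R - 1))^-1.
  rewrite -[leRHS]div1r ler_pdivlMr; last by rewrite mulr_gt0// subr_gt0.
  rewrite -(ler_pM2r (exprn_gt0 2 pR)) in hS.
  rewrite -exprMn mulVf ?gt_eqF// expr1n in hS.
  suff -> : S * (p%:R * (p%:R - 1)) = (1 - p%:R^-1) * S * p%:R ^+ 2 by [].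
  by field; rewrite gt_eqF.
apply: le_trans (ler_wpM2l _ hS) _; first by rewrite invr_ge0 mulr_ge0// ltW.
by rewrite -invfM mulrA.
Qed.

(** From p <= 2^(p-1). *)
Lemma ln_le_ln2M p : (0 < p)%N -> ln (p%:R : R) <= ln 2%:R * (p%:R - 1).
Proof.
case: p => // p _; rewrite -natr1 addrK mulrC -ln_natX// natr1.
by rewrite ler_ln_nat// ltn_expl.
Qed.

Lemma erdos_flow_out X m : (1 < m < X)%N ->
  \sum_(1 <= n < X | E m n) erdos_flow X m n <= erdos_weight m.
Proof.
move=> /andP[m1 mX]; have m0 : (0 < m)%N by lia.
have mR : 0 < (m%:R : R) by rewrite ltr0n.
have mR1 : 2%:R <= (m%:R : R) by rewrite ler_nat.
have l0 := ln_nat_gt0 R m m1; have l2 := ln_nat_gt0 R 2 isT.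
under eq_bigr do rewrite /erdos_flow mulrDr !big_distrr/=.
rewrite big_split/=.
have G0 n (x : R) : 0 <= x -> 0 <= erdos_weight n / ln n%:R * x.
  by move=> x0; rewrite mulr_ge0 ?divr_ge0 ?erdos_weight_ge0 ?ln_nat_ge0.
apply: le_trans (lerD (sum_fiber_le R (E m) (fun q => m * q)%N
  (fun q n => erdos_weight n / ln n%:R * mangoldt R q) 1 X X _)
  (sum_fiber_le R (E m) (fun k => m ^ k)%N
  (fun k n => erdos_weight n / ln n%:R * (if prime m then ln m%:R else 0))
  2 X X _)) _.
- by move=> q n; rewrite G0 ?mangoldt_ge0.
- by move=> k n; rewrite G0 ?prime_ln_ge0.
have -> : \sum_(1 <= q < X)
    erdos_weight (m * q) / ln (m * q)%:R * mangoldt R q =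
  m%:R^-1 * \sum_(1 <= q < X) mangoldt R q / (q%:R * ln (m * q)%:R ^+ 2).
  rewrite big_distrr/=; apply: eq_big_nat => q /andP[q0 _].
  have lq : 0 < ln (m * q)%:R :> R by rewrite ln_nat_gt0//; lia.
  rewrite /erdos_weight [in X in (X * _)^-1]natrM.
  by field; rewrite ?gt_eqF// ltr0n.
have B1 := sum_mangoldt_log2_le m X m1.
rewrite -(ler_pM2l (_ : 0 < m%:R^-1)) in B1; last by rewrite invr_gt0.
have c0 : 0 < ln (m%:R : R) + ln 2%:R / 2%:R by rewrite addr_gt0// divr_gt0.
have [pm|_] := boolP (prime m); last first.
  rewrite [X in _ + X]big1 ?addr0; last by move=> k _; rewrite mulr0.
  apply: le_trans B1 _; rewrite /erdos_weight invfM ler_pM2l ?invr_gt0//.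
  by rewrite lef_pV2 ?posrE// lerDl divr_ge0// ltW.
apply: le_trans (lerD B1 (erdos_flow_out_prime_power m X pm)) _.
have lm := ln_le_ln2M m m0.
rewrite /erdos_weight.
set l := ln (m%:R : R) in l0 c0 lm *; set a := ln (2%:R : R) in l2 c0 lm *.
set x := (m%:R : R) in mR mR1 lm *.
have x1 : 0 < x - 1 by lra.
(* For prime m the slack due to ln 2 / 2 must cover the second sum. With denominators cleared this
   reads l + a/2 <= 2 a (x - 1), which follows from l <= a (x - 1) and x >= 2. *)
rewrite -subr_ge0.
have -> : (x * l)^-1 - (x^-1 * (l + a / 2%:R)^-1 + (4%:R * l * x * (x - 1))^-1)
  = (2%:R * a * (x - 1) - (l + a / 2%:R)) /
    (4%:R * l * x * (x - 1) * (l + a / 2%:R)).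
  by field; rewrite !gt_eqF//; lra.
rewrite divr_ge0//; last by rewrite !mulr_ge0// ltW.
have : a * 1 <= a * (x - 1) by rewrite ler_pM2l//; lra.
lra.
Qed.

(** * Finite sums over primitive sets and over primes *)

Lemma primitive_sum_le X (A : pred nat) :
  (forall a, A a -> (1 < a)%N) ->
  (forall a b, A a -> A b -> (a %| b)%N -> a = b) ->
  \sum_(1 <= a < X | A a) erdos_weight a <=
  \sum_(1 <= p < X | prime p) erdos_weight p.
Proof.
apply: (antichain_flow_le R erdos_weight (erdos_flow X)).
- exact: erdos_weight_ge0.
- exact: erdos_flow_ge0.
- exact: erdos_flow_in.
- exact: erdos_flow_out.
Qed.

(** In the bound for m = 2 the term q = p is ln p / (p ln(2p)^2), at least a quarter of the weight
    of p because ln(2p) <= 2 ln p. *)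
Lemma prime_sum_bounded X :
  \sum_(1 <= p < X | prime p) erdos_weight p <= 4%:R / ln 2%:R.
Proof.
have l2 := ln_nat_gt0 R 2 isT.
apply: le_trans (_ : 4%:R * (ln 2%:R + ln 2%:R / 2%:R)^-1 <= _); last first.
  rewrite ler_pM2l// lef_pV2 ?posrE ?addr_gt0 ?divr_gt0//.
  by rewrite lerDl divr_ge0// ltW.
apply: le_trans (ler_wpM2l _ (sum_mangoldt_log2_le 2 X isT)) => //.
rewrite big_distrr/= big_mkcond/=.
rewrite big_nat_cond [leRHS]big_nat_cond; apply: ler_sum.
move=> p /andP[/andP[p0 _] _]; case: ifP => [pp|_]; last first.
  by rewrite mulr_ge0// divr_ge0 ?mangoldt_ge0// mulr_ge0// exprn_ge0// ln_nat_ge0.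
rewrite mangoldt_prime// /erdos_weight ln_natM//.
have p1 := prime_gt1 pp; have lp := ln_nat_gt0 R p p1.
have l2p : ln (2%:R : R) <= ln p%:R by rewrite ler_ln_nat.
have pR : 0 < (p%:R : R) by rewrite ltr0n.
set a := ln (2%:R : R) in l2 l2p *; set l := ln (p%:R : R) in lp l2p *.
rewrite -subr_ge0.
have -> : 4%:R * (l / (p%:R * (a + l) ^+ 2)) - (p%:R * l)^-1 =
  (l - a) * (3%:R * l + a) / (p%:R * (a + l) ^+ 2 * l).
  by field; rewrite !gt_eqF// addr_gt0.
rewrite divr_ge0//; first by rewrite mulr_ge0 ?subr_ge0//; lra.
by rewrite !mulr_ge0// ?exprn_ge0//; lra.
Qed.

Lemma sum_erdos_weight0 X (P : pred nat) :
  \sum_(0 <= n < X | P n) erdos_weight n = \sum_(1 <= n < X | P n) erdos_weight n.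
Proof.
case: X => [|X]; first by rewrite !big_geq.
rewrite big_ltn_cond// /erdos_weight mul0r invr0 add0r.
by case: ifP.
Qed.

Lemma erdos_sumE (P : set nat) :
  erdos_sum R P = (\sum_(i <oo | i \in P) (erdos_weight i)%:E)%E.
Proof.
rewrite nneseries_esum; last by move=> n _; rewrite lee_fin erdos_weight_ge0.
by rewrite set_mem_set.
Qed.

End Flow.

(** * Passage to infinite sums *)

Theorem theorem1p2 (R : realType) (A : set nat) (hA : primitive A)
    (h8 : forall a, A a -> ~~ (8 %| a)%N) :
  (erdos_sum R A < erdos_prime_sum R + ((237%:R / 10%:R ^+ 9 : R)%:E))%E.
Proof.
case: hA => A1 Aanti.
have cvg_w (P : pred nat) :
    cvgn (fun n => (\sum_(0 <= i < n | P i) (erdos_weight R i)%:E)%E).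
  by apply: is_cvg_nneseries_cond => n _ _; rewrite lee_fin erdos_weight_ge0.
have primeE X : \sum_(0 <= p < X | p \in [set p | prime p]) erdos_weight R p =
    \sum_(1 <= p < X | prime p) erdos_weight R p.
  rewrite sum_erdos_weight0; apply: eq_bigl => p.
  by apply/idP/idP; rewrite in_setE.
(* Both sides are limits of sums over n < X, where the finite comparison applies. *)
have AP : (erdos_sum R A <= erdos_prime_sum R)%E.
  rewrite /erdos_prime_sum !erdos_sumE; apply: lee_lim => //; apply: nearW => X.
  rewrite !sumEFin lee_fin primeE sum_erdos_weight0.
  apply: primitive_sum_le => [a|a b]; rewrite !in_setE; first exact: A1.
  move=> Aa Ab adb; apply/eqP/negP => /negP/eqP ab.
  by have := Aanti a b Aa Ab ab; rewrite adb.
(* Finiteness yields strictness: +oo would absorb the added constant. *)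
have Pfin : (erdos_prime_sum R <= (4%:R / ln 2%:R)%:E)%E.
  rewrite /erdos_prime_sum erdos_sumE; apply: lime_le => //; apply: nearW => X.
  by rewrite sumEFin lee_fin primeE prime_sum_bounded.
have P0 : (0 <= erdos_prime_sum R)%E.
  rewrite /erdos_prime_sum erdos_sumE; apply: nneseries_ge0 => n _ _.
  by rewrite lee_fin erdos_weight_ge0.
apply: le_lt_trans AP _; rewrite lteDl.
  by rewrite lte_fin divr_gt0// exprn_gt0.
by rewrite ge0_fin_numE// (le_lt_trans Pfin) ?ltry.
Qed.
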